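(* Let $\mathscr{C}$ be the set of all Coe-semigroups, and let $G(\mathscr{C})$ be the graph with vertex set $\mathscr{C}$ in which $(S,T)\in\mathscr{C}\times\mathscr{C}$ is an edge if $T=S\cup\{F(S)-1,F(S)\}$. Then $G(\mathscr{C})$ is a tree with root $\mathbb{N}$.
   Context: $\mathbb{N}=\{0,1,2,\ldots\}$. A numerical semigroup is a subset of $\mathbb{N}$ containing $0$, closed under addition and with finite complement in $\mathbb{N}$. A numerical semigroup $S$ is a Coe-semigroup if $\{x-1,x+1\}\subseteq S$ for every odd $x\in S$. The Frobenius number is $F(S)=\max(\mathbb{Z}\setminus S)$ (so $F(\mathbb{N})=-1$). A graph is a pair $(V,E)$ with $V$ a nonempty set and $E\subseteq\{(u,v)\mid u,v\in V,\ u\neq v\}$ (edges are ordered pairs of distinct vertices). A path of length $n$ connecting $u$ and $v$ is a sequence of $n$ distinct edges $(v_0,v_1),(v_1,v_2),\ldots,(v_{n-1},v_n)$ with $v_0=u$ and $v_n=v$. A graph is a tree with root $r$ if for every vertex $v\neq r$ there exists a unique path connecting $v$ and $r$. *)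

(* Defs.v *)
(* MathComp, with the classical sets of MathComp-Analysis. *)
From mathcomp Require Import all_boot all_order all_algebra.
From mathcomp Require Import boolp classical_sets cardinality.
From mathcomp Require Import zify.

Set Implicit Arguments.
Unset Strict Implicit.
Unset Printing Implicit Defensive.

Local Open Scope classical_set_scope.
Local Open Scope ring_scope.

Definition numerical_semigroup (S : set nat) : Prop :=
  [/\ S 0%N,
      forall x y : nat, S x -> S y -> S (x + y)%N
    & finite_set (~` S)].

(* The truncated predecessor [x.-1] is [x - 1] here, since an odd [x] is
   positive. *)
Definition Coe_semigroup (S : set nat) : Prop :=
  numerical_semigroup S /\
  forall x : nat, odd x -> S x -> S x.-1 /\ S x.+1.

Definition int_set (S : set nat) : set int := [set Posz n | n in S].

(* The maximum of Z \ S, taken in the integers so that F(N) = -1. It exists as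
   soon as N \ S is finite (see [frobeniusP]); the default value 0 of [xget] is
   then irrelevant. *)
Definition frobenius (S : set nat) : int :=
  xget 0 ((~` int_set S) `&` ubound (~` int_set S)).

Lemma int_setE (S : set nat) (n : nat) : int_set S (Posz n) = S n.
Proof. by apply/propext; split=> [[m Sm [<-]]|Sn] //; exists n. Qed.

Lemma frobeniusP (S : set nat) : finite_set (~` S) ->
  (~` int_set S) (frobenius S) /\ ubound (~` int_set S) (frobenius S).
Proof.
move=> /finite_seqP[s sE].
suff: exists F, ((~` int_set S) `&` ubound (~` int_set S)) F.
  by move=> /(xgetPex 0)[].
pose P b := `[< forall n, (b <= n)%N -> S n >].
have exP : exists b, P b.
  exists (\max_(i <- s) i).+1; apply/asboolP => n lt_n.
  apply: contrapT => nSn; have : (~` S) n by [].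
  rewrite sE /= => s_n; have := @leq_bigmax_seq _ s xpredT id n s_n isT.
  by rewrite leqNgt lt_n.
case: (ex_minnP exP) => b /asboolP Sb minb.
exists (b%:Z - 1); split.
  move=> [m Sm mE]; have bE : b = m.+1 by lia.
  suff /minb : P m by rewrite bE ltnn.
  apply/asboolP => n; rewrite leq_eqVlt => /predU1P[<- //|lt_mn].
  by apply: Sb; rewrite bE.
move=> [z nSz|z _]; last by lia.
have /negP : ~ (b <= z)%N by move=> /Sb; rewrite -int_setE.
by lia.
Qed.

Lemma frobenius_setT : frobenius [set: nat] = -1.
Proof.
have [] := @frobeniusP [set: nat]; first by rewrite setCT.
set F := frobenius _ => nF /(_ (- 1)) ubF.
have : - 1 <= F by apply: ubF => -[].
by case: F nF {ubF} => [n|n] nF; [case: nF; exists n|lia].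
Qed.

Record graph (T : eqType) := Graph {
  vertices : set T;
  edges : set (T * T);
  vertices_neq0 : vertices !=set0;
  edges_sub : edges `<=`
    [set e | [/\ vertices e.1, vertices e.2 & e.1 <> e.2]] }.

(* A path is identified with its sequence of edges
   (x 0, x 1), ..., (x (n - 1), x n), which must be pairwise distinct;
   its length n is [size p]. *)
Definition path_connecting (T : eqType) (G : graph T) (u v : T)
    (p : seq (T * T)) : Prop :=
  [/\ exists x : nat -> T,
        [/\ x 0%N = u, x (size p) = v
          & p = mkseq (fun i => (x i, x i.+1)) (size p)],
      uniq p
    & forall e, e \in p -> edges G e].

Definition tree_with_root (T : eqType) (G : graph T) (r : T) : Prop :=
  vertices G r /\
  forall v : T, vertices G v -> v <> r -> exists! p, path_connecting G v r p.

Definition Coe_edges : set (set nat * set nat) :=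
  [set ST | [/\ Coe_semigroup ST.1, Coe_semigroup ST.2
    & int_set ST.2 =
      int_set ST.1 `|` [set frobenius ST.1 - 1; frobenius ST.1]]].

Lemma Coe_semigroup_setT : Coe_semigroup [set: nat].
Proof. by do 2!split=> //; rewrite setCT. Qed.

Lemma Coe_semigroups_neq0 : Coe_semigroup !=set0.
Proof. by exists [set: nat]; exact: Coe_semigroup_setT. Qed.

Lemma Coe_edges_sub : Coe_edges `<=`
  [set e | [/\ Coe_semigroup e.1, Coe_semigroup e.2 & e.1 <> e.2]].
Proof.
move=> [S T] [/= CS CT TE]; split=> //= eST; subst T.
have [[_ _ /frobeniusP[nF _]] _] := CS.
by apply: nF; rewrite TE; right; right.
Qed.

Definition Coe_graph : graph (set nat) :=
  Graph Coe_semigroups_neq0 Coe_edges_sub.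

(* Main.v *)
(* If a Coe-semigroup S is not N, then F(S) is odd and S together with
   F(S) - 1 and F(S) is again a Coe-semigroup, with a smaller Frobenius number;
   so S has exactly one outgoing edge, and following these edges reaches N. No
   edge leaves N because F(N) = -1, so the walk from S to N is forced. Its edges
   are distinct since the sets strictly increase along it. *)
Require Import Defs.
From mathcomp Require Import all_boot classical_sets.
From mathcomp Require Import all_order all_algebra boolp cardinality zify.

Set Implicit Arguments.
Unset Strict Implicit.
Unset Printing Implicit Defensive.

Local Open Scope classical_set_scope.

Lemma int_set_inj : injective int_set.
Proof. by move=> S T eST; apply/funext => n; rewrite -!int_setE eST. Qed.

Lemma frobenius_eq (S : set nat) (k : nat) :
  ~ S k -> (forall n, (k < n)%N -> S n) -> frobenius S = Posz k.
Proof.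
move=> nSk Sk; have finS : finite_set (~` S).
  apply: (sub_finite_set _ (finite_II k.+1)) => n /= nSn.
  by rewrite ltnNge; apply/negP => /Sk.
have [nF ubF] := frobeniusP finS.
have leF : (Posz k <= frobenius S)%R by apply: ubF; rewrite /setC /= int_setE.
case: (frobenius S) nF leF {ubF} => [m|m] nF leF; last by lia.
case: (ltnP k m) => [/Sk Sm|lemk]; last by congr Posz; lia.
by case: nF; rewrite int_setE.
Qed.

Lemma Coe_edge_fun (S T U : set nat) :
  Coe_edges (S, T) -> Coe_edges (S, U) -> T = U.
Proof. by move=> [/= _ _ TE] [/= _ _ UE]; apply: int_set_inj; rewrite TE UE. Qed.

Lemma Coe_edge_sub (S T : set nat) : Coe_edges (S, T) -> S `<=` T.
Proof. by move=> [/= _ _ TE] n Sn; rewrite -int_setE TE; left; rewrite int_setE. Qed.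

(** The witness is F(S): it lies outside [S], and being in [int_set T] it is a natural number. This
    also rules out F(S) = -1, so no walk continues past N. *)
Lemma Coe_edge_nsub (S T : set nat) : Coe_edges (S, T) -> ~ (T `<=` S).
Proof.
move=> [/= [[_ _ /frobeniusP[nF _]] _] _ TE] sTS; apply: nF.
have [n Tn <-] : int_set T (frobenius S) by rewrite TE; right; right.
by rewrite int_setE; exact: sTS.
Qed.

Lemma Coe_edge_setT (T : set nat) : ~ Coe_edges ([set: nat], T).
Proof. by move=> /Coe_edge_nsub; apply. Qed.

(** Here [k] is F(S). It is odd: otherwise [k.+1] would be an odd element of [S], forcing [k] into
    [S]. The last clause drives the induction in [Coe_walk_ex]. *)
Lemma Coe_edge_ex (S : set nat) (k : nat) :
    Coe_semigroup S -> ~ S k -> (forall n, (k < n)%N -> S n) ->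
  exists T, Coe_edges (S, T) /\ (forall n, (k <= n)%N -> T n).
Proof.
move=> CS nSk Sk; have [[S0 SD Sfin] Sodd] := CS.
have k_odd : odd k.
  apply/negPn/negP => k_even; apply: nSk.
  by have [] := Sodd k.+1 k_even (Sk _ (ltnSn k)).
(* Being odd, F(S) is positive; from here on it is [k.+1], and the adjoined elements are [k] and
   [k.+1]. *)
case: k nSk Sk k_odd => // k nSk Sk k_odd.
have nS1 : ~ S 1%N.
  move=> S1; apply: nSk; elim: k.+1 => // m Sm.
  by rewrite -addn1; exact: SD.
pose T := S `|` [set n | n = k \/ n = k.+1].
have Tk n : (k.+1 <= n)%N -> T n.
  rewrite leq_eqVlt => /predU1P[<-|/Sk]; [by right; right | by left].
have Tge n : (k <= n)%N -> T n.
  by rewrite leq_eqVlt => /predU1P[<-|/Tk //]; right; left.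
exists T; split=> //; split=> //=; last first.
  rewrite (frobenius_eq nSk Sk); apply/seteqP; split.
    move=> _ [n [Sn|[->|->]] <-]; first by left; rewrite int_setE.
      by right; left => /=; lia.
    by right; right.
  move=> z [[n Sn <-]|[->|->]]; first by exists n => //; left.
    by exists k; [right; left | lia].
  by exists k.+1 => //; right; right.
split.
  split; first by left.
  (* A sum with an adjoined term is at least [k], hence in [T]. *)
  - move=> x y [Sx|Tx] [Sy|Ty]; first by left; exact: SD.
    + by apply: Tge; case: Ty => ->; lia.
    + by apply: Tge; case: Tx => ->; lia.
    + by apply: Tge; case: Tx => ->; lia.
  - by apply: sub_finite_set Sfin => n nTn Sn; apply: nTn; left.
(* The only odd adjoined element is [k.+1], and both its neighbours are at least [k]. *)
move=> x x_odd [/(Sodd _ x_odd)[]|[xE|->]]; first by split; left.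
  by move: k_odd; rewrite /= -xE x_odd.
by split; apply: Tge => /=; lia.
Qed.

Lemma Coe_walk_ex (S : set nat) : Coe_semigroup S ->
  exists (x : nat -> set nat) (n : nat),
    [/\ x 0%N = S, x n = [set: nat]
      & forall i, (i < n)%N -> Coe_edges (x i, x i.+1)].
Proof.
move=> CS; have [k Sk] : exists k, forall n, (k <= n)%N -> S n.
  have [[_ _ /frobeniusP[_ ubF]] _] := CS.
  (* The absolute value turns F(S), possibly -1, into a natural bound; it need not be sharp. *)
  exists `|frobenius S|%N.+1 => n len; apply: contrapT => nSn.
  have : (Posz n <= frobenius S)%R by apply: ubF; rewrite /setC /= int_setE.
  by lia.
elim: k S CS Sk => [|k IH] S CS Sk.
  by exists (fun=> S), 0%N; split=> //; apply/seteqP; split=> // n _; exact: Sk.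
(* If [k] is in [S], the bound drops with [S] unchanged; otherwise [k] is F(S) and the walk takes
   one edge. *)
have [Sk0|nSk] := pselect (S k).
  by apply: IH => // n; rewrite leq_eqVlt => /predU1P[<- //|/Sk].
have [T [eST Tk]] := Coe_edge_ex CS nSk Sk.
have [_ CT _] := eST; have [x [n [x0 xn xe]]] := IH T CT Tk.
exists (fun i => if i is j.+1 then x j else S), n.+1; split=> //.
by case=> [_|i /xe //]; rewrite x0.
Qed.

Lemma Coe_walk_sub (x : nat -> set nat) (n : nat) :
    (forall i, (i < n)%N -> Coe_edges (x i, x i.+1)) ->
  forall i j, (i <= j)%N -> (j <= n)%N -> x i `<=` x j.
Proof.
move=> xe i; elim=> [|j IH]; first by rewrite leqn0 => /eqP-> _ k.
rewrite leq_eqVlt => /predU1P[-> _ k //|leij] ltjn.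
exact: subset_trans (IH leij (ltnW ltjn)) (Coe_edge_sub (xe j ltjn)).
Qed.

(** For i < j, the equality [x i = x j] would give [x i.+1]<=[x i], against the strict growth along
    an edge. *)
Lemma Coe_walk_inj (x : nat -> set nat) (n : nat) :
    (forall i, (i < n)%N -> Coe_edges (x i, x i.+1)) ->
  forall i j, (i < n)%N -> (j < n)%N -> x i = x j -> i = j.
Proof.
move=> xe; suff xne i j : (i < j)%N -> (j < n)%N -> x i <> x j.
  move=> i j ltin ltjn eij; case: (ltngtP i j) => // lt.
    by case: (xne i j).
  by case: (xne j i).
move=> ltij ltjn eij; apply: (Coe_edge_nsub (xe i (ltn_trans ltij ltjn))).
by rewrite eij; apply: (Coe_walk_sub xe) => //; exact: ltnW.
Qed.

Lemma Coe_walk_agree (x y : nat -> set nat) (m n : nat) :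
    x 0%N = y 0%N ->
    (forall i, (i < m)%N -> Coe_edges (x i, x i.+1)) ->
    (forall i, (i < n)%N -> Coe_edges (y i, y i.+1)) ->
  forall i, (i <= m)%N -> (i <= n)%N -> x i = y i.
Proof.
move=> xy0 xe ye; elim=> // i IH ltim ltin.
apply: (Coe_edge_fun (xe i ltim)).
by rewrite (IH (ltnW ltim) (ltnW ltin)); exact: ye.
Qed.

(** If n > m, the walks agree up to m, so [y m] is N and would have an outgoing edge. *)
Lemma Coe_walk_size (x y : nat -> set nat) (m n : nat) :
    x 0%N = y 0%N -> x m = [set: nat] ->
    (forall i, (i < m)%N -> Coe_edges (x i, x i.+1)) ->
    (forall i, (i < n)%N -> Coe_edges (y i, y i.+1)) ->
  (n <= m)%N.
Proof.
move=> xy0 xm xe ye; rewrite leqNgt; apply/negP => ltmn.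
apply: (@Coe_edge_setT (y m.+1)).
by rewrite -xm (Coe_walk_agree xy0 xe ye) ?(ltnW ltmn) //; exact: ye.
Qed.

Lemma path_connecting_edges (T : eqType) (G : graph T) (x : nat -> T) n :
  (forall e, e \in mkseq (fun i => (x i, x i.+1)) n -> edges G e) <->
  (forall i, (i < n)%N -> edges G (x i, x i.+1)).
Proof.
split=> [xe i ltin|xe e /mapP[i]].
  by apply: xe; apply/mapP; exists i; rewrite ?mem_iota.
by rewrite mem_iota => ltin ->; exact: xe.
Qed.

Theorem proposition9 : tree_with_root Coe_graph [set: nat]%classic.
Proof.
split; first exact: Coe_semigroup_setT.
move=> S CS _; have [x [n [x0 xn xe]]] := Coe_walk_ex CS.
exists (mkseq (fun i => (x i, x i.+1)) n); split.
  split; first by exists x; rewrite size_mkseq.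
    (* Edges of the walk are told apart by their sources. *)
    rewrite map_inj_in_uniq ?iota_uniq // => i j.
    by rewrite !mem_iota => ltin ltjn [/(Coe_walk_inj xe ltin ltjn)].
  exact/(path_connecting_edges Coe_graph).
move=> p [[y [y0 yp pE]] _ pe].
rewrite pE in pe; have {pe}ye := (path_connecting_edges Coe_graph _ _).1 pe.
have xy0 : x 0%N = y 0%N by rewrite x0 y0.
(* Both walks end at N, so neither can be longer than the other. *)
have np : n = size p.
  apply/eqP; rewrite eqn_leq (Coe_walk_size (esym xy0) yp ye xe).
  exact: Coe_walk_size xy0 xn xe ye.
rewrite pE -np; apply/eq_in_map => i; rewrite mem_iota => /= ltin.
by rewrite !(Coe_walk_agree xy0 xe ye) // -?np // ltnW.
Qed.
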